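(* Let $p\in[1,\infty)$ and let $X$ be a normed space with norm $\|\cdot\|_X$. Consider a Bayesian inverse problem with prior $\mu_{\mathrm{prior}}$ and likelihood $L$. Suppose that the following hold for $\mu_{\mathrm{prior}}$-almost every $\theta'\in X$ and every $y^\dagger\in Y$: (A1) $L(\cdot|\theta')$ is a strictly positive probability density function (with respect to $\nu_Y$); (A2) $L(y^\dagger|\cdot)\in \mathbf{L}^1(X,\mu_{\mathrm{prior}})$; (A3) there exists $g\in\mathbf{L}^1(X,\mu_{\mathrm{prior}})$ such that $L(y^\ddagger|\cdot)\le g$ for all $y^\ddagger\in Y$; (A4) $L(\cdot|\theta')$ is continuous on $Y$; and moreover (A5) there exists $g'\in\mathbf{L}^1(X,\mu_{\mathrm{prior}})$ such that $\|\theta'\|_X^p\cdot L(y^\dagger|\theta')\le g'(\theta')$ for $\mu_{\mathrm{prior}}$-a.e. $\theta'\in X$ and all $y^\dagger\in Y$. Then the Bayesian inverse problem is Wasserstein$(p)$ well-posed.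
   Context: Setting. $(Y,\|\cdot\|_Y)$ is a separable Banach space (data space). The parameter space $X$ is a measurable subset of a separable, completely metrisable topological vector space $(X',\mathcal{T}')$; here $X$ is also a normed space whose norm $\|\cdot\|_X$ induces its topology. $X$ and $Y$ carry their Borel $\sigma$-algebras $\mathcal{B}X$, $\mathcal{B}Y$. $\mathrm{Prob}(X)$ is the set of probability measures on $(X,\mathcal{B}X)$, $\mathrm{Prob}(X,\mu)$ the set of those absolutely continuous with respect to $\mu$, and $\mathrm{Prob}_p(X):=\{\mu\in\mathrm{Prob}(X):\int\|\theta\|_X^p\,\mu(\mathrm{d}\theta)<\infty\}$. $\nu_X$ and $\nu_Y$ are $\sigma$-finite measures on $(X,\mathcal{B}X)$ and $(Y,\mathcal{B}Y)$. The prior $\mu_{\mathrm{prior}}\in\mathrm{Prob}(X)$ satisfies $\mu_{\mathrm{prior}}\ll\nu_X$ with density $\pi_{\mathrm{prior}}$. The likelihood $L(y^\dagger|\theta')\ge 0$ is defined for every $y^\dagger\in Y$ and $\mu_{\mathrm{prior}}$-a.e. $\theta'\in X$; $L(\cdot|\theta')$ is the $\nu_Y$-density of the conditional distribution of the data $y$ given $\theta=\theta'$, and $L(y^\dagger|\cdot)$ is measurable. Put $Z(y^\dagger):=\int_X L(y^\dagger|\theta)\,\mathrm{d}\mu_{\mathrm{prior}}(\theta)$. Bayesian inverse problem: for data $y^\dagger\in Y$, find the posterior $\mu_{\mathrm{post}}^\dagger\in\mathrm{Prob}(X,\mu_{\mathrm{prior}})$ with $\nu_X$-density $\theta\mapsto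 L(y^\dagger|\theta)\pi_{\mathrm{prior}}(\theta)/Z(y^\dagger)$. Wasserstein$(p)$ well-posedness: (1) for every $y^\dagger\in Y$, $\mu_{\mathrm{post}}^\dagger\in\mathrm{Prob}_p(X)$ exists, (2) it is unique in $\mathrm{Prob}_p(X)$, and (3) the map $(Y,\|\cdot\|_Y)\ni y^\dagger\mapsto\mu_{\mathrm{post}}^\dagger\in(\mathrm{Prob}_p(X),\mathrm{d}_{\mathrm{Was}(p)})$ is continuous, where $$\mathrm{d}_{\mathrm{Was}(p)}(\mu,\mu'):=\left(\inf_{\Lambda\in\mathrm{C}(\mu,\mu')}\int_{X\times X}\|\theta-\theta'\|_X^p\,\mathrm{d}\Lambda(\theta,\theta')\right)^{1/p}$$ and $\mathrm{C}(\mu,\mu'):=\{\Lambda'\in\mathrm{Prob}(X^2):\mu(B)=\Lambda'(B\times X),\ \mu'(B)=\Lambda'(X\times B)\ \text{for all } B\in\mathcal{B}X\}$ is the set of couplings. *)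

(* Defs.v *)
From HB Require Import structures.
From mathcomp Require Import all_boot all_order all_algebra.
From mathcomp Require Import all_classical all_reals all_analysis.

Set Implicit Arguments.
Unset Strict Implicit.
Unset Printing Implicit Defensive.

Import Order.TTheory GRing.Theory Num.Theory.
Import numFieldNormedType.Exports.

Local Open Scope classical_set_scope.
Local Open Scope ring_scope.

Notation borel T := (g_sigma_algebraType (@open T)).

Definition separable (T : topologicalType) : Prop :=
  exists2 S : set T, countable S & dense S.

Definition completely_metrizable (R : realType) (T : topologicalType) : Prop :=
  exists d : T -> T -> R,
    [/\ [/\ forall x y, d x y = 0 <-> x = y,
            forall x y, d x y = d y x
          & forall x y z, d x z <= d x y + d y z],
        forall (x : T) (A : set T),
          nbhs x A <-> exists2 e, 0 < e & [set y | d x y < e] `<=` A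
      & forall u : nat -> T,
          (forall e, 0 < e -> exists N, forall m n,
            (N <= m)%N -> (N <= n)%N -> d (u m) (u n) < e) ->
          exists l : T, u @ \oo --> l].

(* [emb] exhibits [X] as a Borel subset of [X'], the norm topology of [X] being
   the subspace topology. *)
Definition parameter_space (R : realType) (X' : topologicalLmodType R)
    (X : normedModType R) (emb : X -> X') : Prop :=
  [/\ separable X', completely_metrizable R X',
      injective emb,
      <<s @open X' >> (range emb)
    & @open X = [set emb @^-1` B | B in @open X']].

Definition is_density (R : realType) (d : measure_display)
    (T : measurableType d) (nu mu : {measure set T -> \bar R}) (f : T -> R) :
    Prop :=
  [/\ measurable_fun setT f,
      {ae nu, forall x, 0 <= f x}
    & forall A, measurable A -> mu A = (\int[nu]_(x in A) (f x)%:E)%E].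

Definition is_positive_pdf (R : realType) (d : measure_display)
    (T : measurableType d) (nu : {measure set T -> \bar R}) (f : T -> R) :
    Prop :=
  [/\ measurable_fun setT f, forall x, 0 < f x
    & (\int[nu]_x (f x)%:E)%E = 1%E].

(* [K] is a regular conditional distribution of [data] given [theta]. *)
Definition is_conditional_distribution (R : realType)
    (d d1 d2 : measure_display) (Omega : measurableType d)
    (T1 : measurableType d1) (T2 : measurableType d2) (P : probability Omega R)
    (theta : {RV P >-> T1}) (data : {RV P >-> T2}) (K : R.-pker T1 ~> T2) :
    Prop :=
  forall A B, measurable A -> measurable B ->
    P (theta @^-1` A `&` data @^-1` B) =
    (\int[distribution P theta]_(t in A) K t B)%E.

(* The likelihood [L y t] stands for L(y|t). It is only meaningful for
   [prior]-a.e. [t], and takes arbitrary values elsewhere. *)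
Record inverse_problem (R : realType) (X Y : normedModType R) := {
  nuX : {sigma_finite_measure set (borel X) -> \bar R} ;
  nuY : {sigma_finite_measure set (borel Y) -> \bar R} ;
  prior : probability (borel X) R ;
  prior_density : X -> R ;
  likelihood : Y -> X -> R ;
  omega_display : measure_display ;
  Omega : measurableType omega_display ;
  Pr : probability Omega R ;
  theta : {RV Pr >-> borel X} ;
  data : {RV Pr >-> borel Y} ;
  cond_data : R.-pker borel X ~> borel Y ;
  prior_dominated : prior `<< nuX ;
  prior_densityP : is_density nuX prior prior_density ;
  likelihood_ge0 : {ae prior, forall t, forall y, 0 <= likelihood y t} ;
  measurable_likelihood : forall y,
    measurable_fun setT (likelihood y : borel X -> R) ;
  theta_prior : forall A, measurable A -> distribution Pr theta A = prior A ;
  cond_dataP : is_conditional_distribution theta data cond_data ;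
  likelihoodP : {ae prior, forall t,
    is_density nuY (cond_data t) (likelihood ^~ t)}
}.

Section Posterior.
Context (R : realType) (X Y : normedModType R) (B : inverse_problem X Y).

Definition evidence (y : Y) : \bar R :=
  (\int[prior B]_t (likelihood B y t)%:E)%E.

(* The conditions on [evidence y] are what makes the quotient meaningful. *)
Definition is_posterior (y : Y) (mu : probability (borel X) R) : Prop :=
  [/\ (0 < evidence y < +oo)%E, mu `<< prior B
    & is_density (nuX B) mu
        (fun t => likelihood B y t * prior_density B t / fine (evidence y))].

End Posterior.

Section Wasserstein.
Context (R : realType) (X : normedModType R).

Definition Prob (p : R) : set (probability (borel X) R) :=
  [set mu : probability (borel X) R |
    (\int[mu]_t (`|t : X| `^ p)%:E < +oo)%E].

Definition coupling (mu mu' : probability (borel X) R) :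
    set (probability (borel (X * X)%type) R) :=
  [set Lam : probability (borel (X * X)%type) R |
    forall A : set (borel X), measurable A ->
      mu A = Lam (A `*` setT) /\ mu' A = Lam (setT `*` A)].

Definition wasserstein (p : R) (mu mu' : probability (borel X) R) : \bar R :=
  (ereal_inf [set \int[Lam]_z (`|(z : X * X).1 - (z : X * X).2| `^ p)%:E
             | Lam in coupling mu mu'] `^ p^-1)%E.

End Wasserstein.

(* A measure is a function on all sets, arbitrary outside the sigma-algebra:
   two measures are the same when they agree on measurable sets. *)
Definition wasserstein_well_posed (R : realType) (X Y : normedModType R)
    (p : R) (B : inverse_problem X Y) : Prop :=
  [/\ forall y, exists2 mu, Prob p mu & is_posterior B y mu,
      forall y mu mu', Prob p mu -> is_posterior B y mu ->
        Prob p mu' -> is_posterior B y mu' ->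
        forall A, measurable A -> mu A = mu' A
    & forall post : Y -> probability (borel X) R,
        (forall y, Prob p (post y) /\ is_posterior B y (post y)) ->
        forall y0, wasserstein p (post y) (post y0) @[y --> y0] --> 0%E].

(* Main.v *)
Require Import Defs.
From HB Require Import structures.
From mathcomp Require Import all_boot all_order all_algebra.
From mathcomp Require Import all_classical all_reals all_analysis.
From mathcomp Require Import measurable_realfun lra.

Set Implicit Arguments.
Unset Strict Implicit.
Unset Printing Implicit Defensive.

Import Order.TTheory GRing.Theory Num.Theory.
Import numFieldNormedType.Exports.

Local Open Scope classical_set_scope.
Local Open Scope ring_scope.

(** The posteriors for all data y have densities f_y = L(y|.) / Z(y) with
    respect to one and the same measure, the prior. Existence and uniqueness
    are then a matter of normalisation: Z(y) is positive because L(y|.) is,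
    and finite because L(y|.) is integrable, and the dominating function of
    (A5) bounds the p-th moment.

    For continuity, weak convergence is bypassed by an explicit coupling. Two
    probability measures with densities f and g with respect to mu are coupled
    by leaving their common part min(f, g) mu on the diagonal and transporting
    the excess (f - min(f, g)) mu onto the excess (g - min(f, g)) mu by a
    normalised product measure ([maximal_coupling]). Off the diagonal,
    |x - y|^p <= 2^p |x|^p + 2^p |y|^p, so the p-th power of the Wasserstein
    distance is at most the weighted L^1 distance

      int 2^p |x|^p |f(x) - g(x)| mu(dx)

    ([wasserstein_le]). For f = f_y and g = f_y0 this tends to 0 as y tends to
    y0: by dominated convergence with (A3) and (A4), Z is continuous, and then
    by dominated convergence with (A4) and (A5) so is the weighted L^1 distance
    ([cvg_weighted_L1_posterior_density]). Dominated convergence is a statement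
    on sequences, which suffices because Y is metrisable ([cvg_seqP]).

    The coupling lives on the product of the Borel sigma-algebras of X, whereas
    couplings are required on the Borel sigma-algebra of X * X. The two agree
    because X is second countable, as a subspace of a separable metrisable
    space ([parameter_space_second_countable], [measurable_id_borel_prod]). *)

(** * Measures with a density *)

Section Density.
Context d (T : measurableType d) (R : realType).
Implicit Types (f : T -> R).

Lemma exists_density_measure (mu : {measure set T -> \bar R}) f :
  measurable_fun setT f -> (forall x, 0 <= f x) ->
  (\int[mu]_x (f x)%:E < +oo)%E ->
  exists nu : {finite_measure set T -> \bar R},
    forall A, nu A = (\int[mu]_(x in A) (f x)%:E)%E.
Proof.
move=> mf f0 foo.
pose nu A := (\int[mu]_(x in A) (f x)%:E)%E.
have nu0 : nu set0 = 0%E by rewrite /nu integral_set0.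
have nu_ge0 A : (0 <= nu A)%E.
  by apply: integral_ge0 => x _; rewrite lee_fin.
have nu_sa : semi_sigma_additive nu.
  apply: semi_sigma_additive_nng_induced => [|x]; last by rewrite lee_fin.
  exact/measurable_EFinP.
pose m1 := isMeasure.Build _ _ _ nu nu0 nu_ge0 nu_sa.
pose nuM : {measure set T -> \bar R} := HB.pack nu m1.
have nu_fin : fin_num_fun nuM.
  by apply: lty_fin_num_fun.
pose m2 := Measure_isFinite.Build _ _ _ nuM nu_fin.
pose nuF : {finite_measure set T -> \bar R} := HB.pack nu m1 m2.
by exists nuF.
Qed.

(** A property that holds almost everywhere for [nu] may fail on a large set
    for [mu], but only where the density vanishes. *)
Lemma density_ae (mu nu : {measure set T -> \bar R}) f (P : T -> Prop) :
  is_density mu nu f -> {ae nu, forall x, P x} ->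
  {ae mu, forall x, f x != 0 -> P x}.
Proof.
case=> mf f0 nuE [N [mN nuN0 subN]].
have mfp : measurable_fun N (EFin \o f).
  by apply/measurable_EFinP; exact: measurable_funTS.
have : (\int[mu]_(x in N) `|(f x)%:E| = 0)%E.
  rewrite -nuN0 nuE//; apply: ae_eq_integral => //.
    exact: measurableT_comp.
  by apply: filterS f0 => x fx _; rewrite /= ger0_norm.
move/(ae_eq_integral_abs _ mN mfp); apply: filterS => x fN0 fx0.
apply: contrapT => nP; move: fx0; have /= := fN0 (subN _ nP).
by case=> ->; rewrite eqxx.
Qed.

Lemma density_dominated (mu : {measure set T -> \bar R})
    (nu : {measure set T -> \bar R}) f :
  is_density mu nu f -> nu `<< mu.
Proof.
case=> mf f0 nuE; apply/null_content_dominatesP => A mA muA.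
by rewrite nuE// null_set_integral//; apply/measurable_EFinP/measurable_funTS.
Qed.

(** Change of variables along a density: [f] is almost everywhere the
    Radon-Nikodym derivative of [nu] with respect to [mu]. *)
Lemma ge0_integral_density (mu : {sigma_finite_measure set T -> \bar R})
    (nu : {finite_measure set T -> \bar R}) f (h : T -> \bar R) A :
  is_density mu nu f -> measurable A -> measurable_fun setT h ->
  (forall x, 0 <= h x)%E ->
  (\int[nu]_(x in A) h x = \int[mu]_(x in A) (h x * (f x)%:E))%E.
Proof.
move=> dens mA mh h0; have [mf f0 nuE] := dens.
have numu := density_dominated dens.
have mRN := measurable_int _ (Radon_Nikodym_SigmaFinite.f_integrable numu).
rewrite -(Radon_Nikodym_SigmaFinite.change_of_variables numu)//; last first.
  exact: measurable_funTS.
apply: ae_eq_integral => //.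
- by apply: measurable_funTS; exact: emeasurable_funM.
- apply: measurable_funTS; apply: emeasurable_funM => //.
  exact/measurable_EFinP.
- apply: ae_eq_subset (@subsetT _ A) _; apply: ae_eqe_mul2l.
  apply: integral_ae_eq => //.
  + exact: Radon_Nikodym_SigmaFinite.f_integrable.
  + exact/measurable_EFinP.
  + move=> E _ mE; rewrite -nuE//.
    by rewrite -Radon_Nikodym_SigmaFinite.f_integral.
Qed.

End Density.

(** * The maximal coupling *)

Section Coupling.
Context d (T : measurableType d) (R : realType).

Lemma ge0_integral_mixture d' (U : measurableType d')
    (m1 m2 Lam : {measure set U -> \bar R}) (r : {nonneg R}) (c : U -> \bar R) :
  (forall A, measurable A -> Lam A = m1 A + r%:num%:E * m2 A)%E ->
  measurable_fun setT c -> (forall z, 0 <= c z)%E ->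
  (\int[Lam]_z c z = \int[m1]_z c z + r%:num%:E * \int[m2]_z c z)%E.
Proof.
move=> LamE mc c0; rewrite -ge0_integral_mscale//.
rewrite -ge0_integral_measure_add//.
apply: eq_measure_integral => A mA _.
by rewrite LamE//; exact/esym/measure_addE.
Qed.

(** A measure of total mass 1, repackaged as a probability measure. *)
Lemma probability_of_measure d' (U : measurableType d')
    (m : {measure set U -> \bar R}) :
  m setT = 1%E -> exists P : probability U R, forall A, P A = m A.
Proof.
move=> mT; pose nu : set U -> \bar R := m.
pose m1 := isMeasure.Build _ _ _ nu (measure0 m) (measure_ge0 m)
  (@measure_semi_sigma_additive _ _ _ m).
pose nuM : {measure set U -> \bar R} := HB.pack nu m1.
pose m2 := Measure_isProbability.Build _ _ _ nuM mT.
pose P : probability U R := HB.pack nu m1 m2.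
by exists P.
Qed.

(** The coupling that keeps as much mass as possible on the diagonal. A cost [c]
    that vanishes there, and is dominated by [w x + w y] elsewhere, costs at
    most the [w]-weighted L^1 distance of the densities. *)
Lemma maximal_coupling (mu : {sigma_finite_measure set T -> \bar R})
    (P Q : probability T R) (f g : T -> R) :
  is_density mu P f -> is_density mu Q g ->
  (forall x, 0 <= f x) -> (forall x, 0 <= g x) ->
  exists Lam : probability (T * T)%type R,
    (forall A, measurable A ->
      P A = Lam (A `*` setT) /\ Q A = Lam (setT `*` A)) /\
    forall (c : T * T -> \bar R) (w : T -> \bar R),
      measurable_fun setT c -> measurable_fun setT w ->
      (forall z, 0 <= c z)%E -> (forall x, 0 <= w x)%E ->
      (forall x, c (x, x) = 0)%E -> (forall x y, c (x, y) <= w x + w y)%E ->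
      (\int[Lam]_z c z <= \int[mu]_x (w x * `|f x - g x|%:E))%E.
Proof.
move=> Pf Qg f0 g0; have [mf _ PE] := Pf; have [mg _ QE] := Qg.
pose h x := Num.min (f x) (g x).
have h0 x : 0 <= h x by rewrite le_min f0 g0.
have hf x : h x <= f x by rewrite ge_min lexx.
have hg x : h x <= g x by rewrite ge_min lexx orbT.
have mh : measurable_fun setT h by exact: measurable_minr.
have mfh : measurable_fun setT (f \- h) by exact: measurable_funB.
have mgh : measurable_fun setT (g \- h) by exact: measurable_funB.
have fh0 x : 0 <= (f \- h) x by rewrite /= subr_ge0.
have gh0 x : 0 <= (g \- h) x by rewrite /= subr_ge0.
have fin1 (k l : T -> R) (N : probability T R) : is_density mu N l ->
    measurable_fun setT k -> (forall x, 0 <= k x <= l x) ->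
    (\int[mu]_x (k x)%:E < +oo)%E.
  move=> [ml _ NE] mk kl; apply: (@le_lt_trans _ _ (N setT)); last first.
    by rewrite probability_setT ltry.
  rewrite NE//; apply: ge0_le_integral => //; try exact/measurable_EFinP.
  - by move=> x _; rewrite lee_fin; case/andP: (kl x).
  - by move=> x _; rewrite lee_fin; case/andP: (kl x).
(* M, Mf and Mg have densities h, f - h and g - h, so that P = M + Mf and
   Q = M + Mg; both excesses Mf and Mg have the same total mass delta. *)
have [M ME] : exists M : {finite_measure set T -> \bar R},
    forall A, M A = (\int[mu]_(x in A) (h x)%:E)%E.
  apply: exists_density_measure => //.
  by apply: (fin1 _ f P) => // x; rewrite h0 hf.
have [Mf MfE] : exists M : {finite_measure set T -> \bar R},
    forall A, M A = (\int[mu]_(x in A) ((f \- h) x)%:E)%E.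
  apply: exists_density_measure => //.
  by apply: (fin1 _ f P) => // x; rewrite fh0/= gerBl.
have [Mg MgE] : exists M : {finite_measure set T -> \bar R},
    forall A, M A = (\int[mu]_(x in A) ((g \- h) x)%:E)%E.
  apply: exists_density_measure => //.
  by apply: (fin1 _ g Q) => // x; rewrite gh0/= gerBl.
have PM A : measurable A -> (P A = M A + Mf A)%E.
  move=> mA; rewrite PE// ME MfE -ge0_integralD//.
  - by apply: eq_integral => x _; rewrite -EFinD/= addrC subrK.
  - by move=> x _; rewrite lee_fin.
  - exact/measurable_funTS/measurable_EFinP.
  - by move=> x _; rewrite lee_fin.
  - exact/measurable_funTS/measurable_EFinP.
have QM A : measurable A -> (Q A = M A + Mg A)%E.
  move=> mA; rewrite QE// ME MgE -ge0_integralD//.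
  - by apply: eq_integral => x _; rewrite -EFinD/= addrC subrK.
  - by move=> x _; rewrite lee_fin.
  - exact/measurable_funTS/measurable_EFinP.
  - by move=> x _; rewrite lee_fin.
  - exact/measurable_funTS/measurable_EFinP.
pose delta := fine (Mf setT).
have MfT : Mf setT = delta%:E by rewrite /delta fineK// fin_num_measure.
have MgT : Mg setT = delta%:E.
  have : (M setT + Mf setT = M setT + Mg setT)%E.
    by rewrite -PM// -QM// !probability_setT.
  move/(congr1 (fun z => z - M setT)%E).
  by rewrite 2![(M setT + _)%E]addeC !addeK ?fin_num_measure// MfT => <-.
have delta0 : 0 <= delta by rewrite -lee_fin -MfT.
(* This covers delta = 0, with the convention 0^-1 = 0: P = Q, the excesses
   vanish and the coupling is concentrated on the diagonal. *)
have cancel_delta (N : {finite_measure set T -> \bar R}) A : measurable A ->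
    N setT = delta%:E -> (delta^-1%:E * (N A * delta%:E) = N A)%E.
  move=> mA NT; have [d0|dn0] := eqVneq delta 0; last first.
    by rewrite muleC -muleA -EFinM divff// mule1.
  suff -> : N A = 0%E by rewrite mul0e mule0.
  have : (N A <= N setT)%E by apply: le_measure; rewrite ?inE.
  by rewrite NT d0 measure_le0 => /eqP.
pose diag (x : T) := (x, x).
have mdiag : measurable_fun setT diag by exact: measurable_fun_pair.
pose D : {measure set (T * T) -> \bar R} :=
  measure_function_pushforward__canonical__measure_function_Measure M mdiag.
pose r : {nonneg R} := NngNum (eq_ind_r is_true delta0 (invr_ge0 delta)).
pose L : {measure set (T * T) -> \bar R} :=
  measure_add D (mscale r (Mf \x Mg)%E).
have LE A : (L A = M (diag @^-1` A) + delta^-1%:E * (Mf \x Mg) A)%E.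
  exact: (measure_addE D (mscale r (Mf \x Mg)%E)).
have prodE A B : measurable A -> measurable B ->
    (Mf \x Mg)%E (A `*` B) = (Mf A * Mg B)%E.
  exact: product_measure1E.
have L1 A : measurable A -> P A = L (A `*` setT).
  move=> mA; rewrite LE prodE// MgT cancel_delta// PM//.
  by congr (M _ + _)%E; apply/seteqP; split => x //= [].
have L2 A : measurable A -> Q A = L (setT `*` A).
  move=> mA; rewrite LE prodE// MfT [(delta%:E * _)%E]muleC.
  rewrite cancel_delta// QM//.
  by congr (M _ + _)%E; apply/seteqP; split => x //= [].
have LT : L setT = 1%E by rewrite -setXTT -L1// probability_setT.
have [LP LPE] := probability_of_measure LT.
exists LP; split=> [A mA|c w mc mw c0 w0 cdiag cw].
  by rewrite !LPE; split; [exact: L1|exact: L2].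
rewrite (@ge0_integral_mixture _ _ D (Mf \x Mg)%E LP r)//; last first.
  by move=> A _; exact: etrans (LPE A) (LE A).
have -> : (\int[D]_z c z = 0)%E.
  have /= := ge0_integral_pushforward mdiag M measurableT mc.
  move=> -> //.
  by rewrite integral0_eq// => x _; exact: cdiag.
rewrite add0e fubini_tonelli1//= /fubini_F.
have wf : (\int[Mf]_x w x = \int[mu]_x (w x * ((f \- h) x)%:E))%E.
  apply: ge0_integral_density => //; split => //; first by apply: aeW.
  by move=> A _; exact: MfE.
have wg : (\int[Mg]_x w x = \int[mu]_x (w x * ((g \- h) x)%:E))%E.
  apply: ge0_integral_density => //; split => //; first by apply: aeW.
  by move=> A _; exact: MgE.
have -> : (\int[mu]_x (w x * `|f x - g x|%:E) =
    \int[Mf]_x w x + \int[Mg]_x w x)%E.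
  rewrite wf wg -ge0_integralD//.
  - apply: eq_integral => x _; rewrite -ge0_muleDr ?lee_fin// -EFinD /h /=.
    congr (_ * _%:E)%E; case: (leP (f x) (g x)) => fg.
    + by rewrite ler0_norm ?subr_le0//; lra.
    + by rewrite gtr0_norm ?subr_gt0//; lra.
  - by move=> x _; rewrite mule_ge0// lee_fin.
  - by apply: emeasurable_funM => //; exact/measurable_EFinP.
  - by move=> x _; rewrite mule_ge0// lee_fin.
  - by apply: emeasurable_funM => //; exact/measurable_EFinP.
have Wf0 : (0 <= \int[Mf]_x w x)%E by exact: integral_ge0.
have Wg0 : (0 <= \int[Mg]_x w x)%E by exact: integral_ge0.
have [d0|dn0] := eqVneq delta 0; first by rewrite d0 invr0 mul0e adde_ge0.
apply: (@le_trans _ _ (delta^-1%:E *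
    \int[Mf]_x (w x * delta%:E + \int[Mg]_y w y))%E).
  apply: lee_wpmul2l; first by rewrite lee_fin invr_ge0.
  apply: ge0_le_integral => //.
  - by move=> x _; exact: integral_ge0.
  - exact: measurable_fun_fubini_tonelli_F.
  - by apply: emeasurable_funD => //; exact: emeasurable_funM.
  - move=> x _; rewrite -MgT -(integral_cst Mg measurableT (w x)).
    rewrite -ge0_integralD//; last by move=> y _; exact: w0.
    apply: ge0_le_integral => //.
    + exact: measurableT_comp.
    + exact: emeasurable_funD.
rewrite ge0_integralD//; last 2 first.
- by move=> x _; rewrite mule_ge0// lee_fin.
- exact: emeasurable_funM.
have -> : (\int[Mf]_x (\int[Mg]_y w y) = (\int[Mg]_y w y) * delta%:E)%E.
  by rewrite -MfT; exact: integral_cst.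
rewrite ge0_integralZr ?lee_fin// -ge0_muleDl//.
by rewrite muleC -muleA -EFinM divff// mule1.
Qed.

End Coupling.

(** * Borel sets of second countable spaces and their products *)

Section Borel.

Lemma countable_bigcup_measurable d (T : measurableType d) (I : Type)
    (D : set I) (F : I -> set T) :
  countable D -> (forall i, D i -> measurable (F i)) ->
  measurable (\bigcup_(i in D) F i).
Proof.
move=> /countable_injP[f finj] mF.
rewrite (_ : \bigcup_(i in D) F i =
    \bigcup_n \bigcup_(i in D `&` f @^-1` [set n]) F i); last first.
  apply/seteqP; split => x.
    by move=> [i Di Fix]; exists (f i) => //; exists i.
  by move=> [n _ [i [Di _] Fix]]; exists i.
apply: bigcup_measurable => n _.
have [[i [Di fi]]|nD] := pselect (exists i, D i /\ f i = n).
  rewrite (_ : _ `&` _ = [set i]); first by rewrite bigcup_set1; exact: mF.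
  apply/seteqP; split => j /=; last by move=> ->.
  by move=> [Dj fj]; apply: finj; rewrite ?inE// fi.
rewrite (_ : _ `&` _ = set0) ?bigcup_set0//.
by apply/seteqP; split => j //= [Dj fj]; apply: nD; exists j.
Qed.

Lemma measurable_fun_open d (T : measurableType d) (R : realType) (f : T -> R) :
  (forall U : set R, open U -> measurable (f @^-1` U)) -> measurable_fun setT f.
Proof.
move=> fU; apply: (measurability _ (RGenOpens.measurableE R)).
by move=> _ [_ [a [b ->] <-]]; rewrite setTI; exact/fU/interval_open.
Qed.

(** The product sigma-algebra contains the open sets of the product topology:
    by second countability each of them is a countable union of boxes. *)
Lemma measurable_id_borel_prod (T : ptopologicalType) :
  @second_countable T ->
  measurable_fun setT (id : borel T * borel T -> borel (T * T)%type).
Proof.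
move=> [Bs cB [Bopen Bbase]].
have sE : @measurable _ (borel (T * T)%type) = <<s @open (T * T)%type >> by [].
apply: (@measurability _ _ (borel T * borel T)%type (borel (T * T)%type) _ _ _ sE).
move=> _ [U oU <-].
rewrite setTI preimage_id.
pose D := [set b : set T * set T | (Bs `*` Bs) b /\ b.1 `*` b.2 `<=` U].
have -> : U = \bigcup_(b in D) (b.1 `*` b.2).
  apply/seteqP; split => [[x y] Uxy|z [b [_ bU]] /bU//].
  have : nbhs (x, y) U by exact: open_nbhs_nbhs.
  move=> [[V W] /= [Vx Wy] VWU].
  have [V' [BV' V'x] V'V] := Bbase x _ Vx.
  have [W' [BW' W'y] W'W] := Bbase y _ Wy.
  exists (V', W') => //=; split => //= -[a b] [/= V'a W'b].
  by apply: VWU; split => /=; [exact: V'V|exact: W'W].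
apply: countable_bigcup_measurable => [|b [[B1 B2] _]].
  by apply: sub_countable (countableX cB cB); apply: subset_card_le => b [].
by apply: measurableX; apply: sub_sigma_algebra; exact: Bopen.
Qed.

(** Pull back along [emb] the balls of radius [1 / (n + 1)] centred at the points
    of a countable dense subset of [X']. *)
Lemma parameter_space_second_countable (R : realType)
    (X' : topologicalLmodType R) (X : normedModType R) (emb : X -> X') :
  parameter_space emb -> @second_countable X.
Proof.
move=> [[S cS dS] [d [[d0 dC dT] dnbhs _]] _ _ openX].
pose Bl s n := [set y | d s y < n.+1%:R^-1 :> R].
have Blo s n : open (Bl s n).
  rewrite openE => y /= sy; apply/dnbhs.
  exists (n.+1%:R^-1 - d s y); first by rewrite subr_gt0.
  move=> z /= yz; rewrite /Bl/= (le_lt_trans (dT _ y _))//.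
  by rewrite -ltrBrDl.
exists [set emb @^-1` Bl sn.1 sn.2 | sn in S `*` [set: nat]].
  by apply: sub_countable (card_image_le _ _) _; apply: countableX.
split.
  by move=> _ [sn _ <-]; rewrite openX; exists (Bl sn.1 sn.2).
move=> x A /= nA.
have [U [+ Ux] UA] : exists2 U, open_nbhs x U & U `<=` A.
  by move: nA; rewrite nbhsE.
rewrite openX => -[V oV VU].
have : nbhs (emb x) V.
  by apply: open_nbhs_nbhs; split => //; move: Ux; rewrite -VU.
move=> /dnbhs[e e0 eV].
have e20 : 0 < e / 2 by rewrite divr_gt0.
have [n _ /(_ n (leqnn n)) /= ne] := near_infty_natSinv_lt (PosNum e20).
have [|s [/= xs Ss]] := dS (Bl (emb x) n) _ (Blo _ _).
  by exists (emb x); rewrite /Bl/= (d0 _ _).2// invr_gt0.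
exists (emb @^-1` Bl s n).
  by split; [exists (s, n)|rewrite /Bl/= dC].
move=> z /= sz; apply: UA; rewrite -VU; apply: eV.
have {}sz : d s (emb z) < n.+1%:R^-1 := sz.
have {}xs : d (emb x) s < n.+1%:R^-1 := xs.
have {}ne : n.+1%:R^-1 < e / 2 := ne.
by rewrite /= (le_lt_trans (dT _ s _))// (splitr e) ltrD// (lt_trans _ ne).
Qed.

End Borel.

(** * Sequences and the Wasserstein bound *)

Section Sequences.
Context (R : realType).

(** Sequential continuity implies continuity on a normed space. *)
Lemma cvg_seqP (Y : normedModType R) (T : topologicalType) (f : Y -> T)
    (y0 : Y) (l : T) :
  (forall u : nat -> Y, u n @[n --> \oo] --> y0 ->
    f (u n) @[n --> \oo] --> l) ->
  f y @[y --> y0] --> l.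
Proof.
move=> fu A lA; apply: contrapT => nA.
have hu n : exists y, ball y0 n.+1%:R^-1 y /\ ~ A (f y).
  apply: contrapT => /forallNP h; apply: nA.
  suff : @nbhs _ Y y0 (f @^-1` A) by [].
  apply/nbhs_ballP; exists n.+1%:R^-1 => /=; first by rewrite invr_gt0.
  by move=> y yb; apply: contrapT => nAy; exact: (h y).
have [u uP] := choice hu.
have : u n @[n --> \oo] --> y0.
  apply/cvgrPdist_lt => e e0; near=> n.
  have [+ _] := uP n; rewrite -ball_normE /= => /lt_trans; apply.
  by near: n; exact: (near_infty_natSinv_lt (PosNum e0)).
move=> /fu /(_ _ lA)[N _ /(_ N (leqnn N))] /=.
by have [_] := uP N.
Unshelve. all: end_near. Qed.

Lemma ge0_cvge0P (T : Type) (F : set_system T) {FF : Filter F}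
    (W : T -> \bar R) : (forall x, 0 <= W x)%E ->
  W x @[x --> F] --> 0%E <->
  forall e : R, 0 < e -> \forall x \near F, (W x < e%:E)%E.
Proof.
move=> W0; split=> [W_0 e e0|h A].
  have : nbhs (0%E : \bar R) [set x | (x < e%:E)%E].
    by apply: open_nbhs_nbhs; split; [exact: open_ereal_lt_ereal|].
  by move/W_0.
move=> A0; have /nbhs_ballP[e /= e0 eA] : nbhs (0 : R) (fun r => A r%:E) := A0.
have := h e e0; apply: filterS => x /=; move: (W0 x); case: (W x) => [r| |]//.
rewrite lee_fin lte_fin => r0 re.
by apply: eA; rewrite -ball_normE /= sub0r normrN ger0_norm.
Qed.

End Sequences.

Section WassersteinBound.
Context (R : realType) (X : normedModType R).

Lemma powR_norm_sub_le (p : R) (x y : X) : 0 <= p ->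
  `|x - y| `^ p <= 2 `^ p * `|x| `^ p + 2 `^ p * `|y| `^ p.
Proof.
move=> p0.
have mono (a : R) : `|x - y| <= 2 * a -> 0 <= a ->
    `|x - y| `^ p <= 2 `^ p * a `^ p.
  move=> xya a0; rewrite -powRM// ge0_ler_powR// nnegrE//.
  by rewrite mulr_ge0.
have := ler_normB x y.
have [xy|/ltW yx] := leP `|x| `|y| => h.
  rewrite (@le_trans _ _ (2 `^ p * `|y| `^ p))//; last first.
    by rewrite lerDr mulr_ge0// powR_ge0.
  by apply: mono => //; rewrite (le_trans h)// mulr_natl mulr2n lerD.
rewrite (@le_trans _ _ (2 `^ p * `|x| `^ p))//; last first.
  by rewrite lerDl mulr_ge0// powR_ge0.
by apply: mono => //; rewrite (le_trans h)// mulr_natl mulr2n lerD.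
Qed.

Lemma measurable_powR_norm (p : R) :
  measurable_fun setT (fun x : borel X => `|x : X| `^ p).
Proof.
apply: (measurableT_comp (measurable_powR p)).
apply: measurable_fun_open => U oU; apply: sub_sigma_algebra.
by move/continuousP : (@norm_continuous R X); exact.
Qed.

Lemma measurable_powR_norm_sub (p : R) :
  measurable_fun setT
    (fun z : borel (X * X)%type => `|(z : X * X).1 - (z : X * X).2| `^ p).
Proof.
apply: (measurableT_comp (measurable_powR p)).
apply: measurable_fun_open => U oU; apply: sub_sigma_algebra.
have : continuous (fun z : X * X => `|z.1 - z.2|).
  move=> z; apply: (@continuous_comp _ _ _ (fun z : X * X => z.1 - z.2)).
    by apply: cvgB; [exact: cvg_fst|exact: cvg_snd].
  exact: norm_continuous.
by move/continuousP; exact.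
Qed.

(** The weighted total variation bound on the Wasserstein distance. *)
Lemma wasserstein_le (p : R) (mu : {sigma_finite_measure set (borel X) -> \bar R})
    (P Q : probability (borel X) R) (f g : borel X -> R) :
  @second_countable X -> 0 < p ->
  is_density mu P f -> is_density mu Q g ->
  (forall x, 0 <= f x) -> (forall x, 0 <= g x) ->
  (wasserstein p P Q <=
    (\int[mu]_x (2 `^ p * `|x : X| `^ p * `|f x - g x|)%:E) `^ p^-1)%E.
Proof.
move=> scX p0 Pf Qg f0 g0.
have [Lam [LamPQ Lamc]] := maximal_coupling Pf Qg f0 g0.
have mid := measurable_id_borel_prod scX.
(* The coupling is carried over from the product of the Borel sigma-algebras to
   the Borel sigma-algebra of the product. *)
pose D : {measure set (borel (X * X)%type) -> \bar R} :=
  measure_function_pushforward__canonical__measure_function_Measure Lam mid.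
have DT : D setT = 1%E by exact: (probability_setT Lam).
have [L LE] := probability_of_measure DT.
pose c (z : X * X) := (`|z.1 - z.2| `^ p)%:E.
have mc : measurable_fun setT (c : borel (X * X)%type -> \bar R).
  by apply/measurable_EFinP; exact: measurable_powR_norm_sub.
have c0 z : (0 <= c z)%E by rewrite lee_fin powR_ge0.
apply: gt0_ler_poweR.
- by rewrite invr_ge0 ltW.
- rewrite in_itv/= leey andbT; apply: le_ereal_inf_tmp => _ [M _ <-].
  by apply: integral_ge0 => z _; exact: c0.
- rewrite in_itv/= leey andbT; apply: integral_ge0 => x _.
  by rewrite lee_fin !mulr_ge0// powR_ge0.
apply: (@le_trans _ _ (\int[L]_z c z)%E).
  apply: ereal_inf_lbound; exists L => // A mA.
  have [PA QA] := LamPQ A mA.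
  by rewrite !LE; split.
have -> : (\int[L]_z c z = \int[Lam]_z c z)%E.
  transitivity (\int[D]_z c z)%E.
    by apply: eq_measure_integral => A mA _; exact: LE.
  exact: (ge0_integral_pushforward mid Lam measurableT mc).
apply: le_trans (Lamc c (fun x => (2 `^ p * `|x : X| `^ p)%:E) _ _ _ _ _ _) _ => //.
- exact: measurableT_comp mc mid.
- apply/measurable_EFinP; apply: measurable_funM => //.
  exact: measurable_powR_norm.
- by move=> x; rewrite /c /= subrr normr0 powR0// gt_eqF.
- by move=> x y; rewrite -EFinD lee_fin powR_norm_sub_le// ltW.
Qed.

End WassersteinBound.

(** * The posterior density *)

Section AlmostEverywhere.
Context d (T : measurableType d) (R : realType) (mu : {measure set T -> \bar R}).

(** Monotonicity of almost everywhere truth. The carrier is that of the measure,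
    so that both lemmas apply to predicates on [X] for measures on [borel X]. *)
Lemma ae_imply (P Q : T -> Prop) :
  (forall x, P x -> Q x) -> {ae mu, forall x, P x} -> {ae mu, forall x, Q x}.
Proof. exact: filterS. Qed.

Lemma ae_imply2 (P Q S : T -> Prop) : (forall x, P x -> Q x -> S x) ->
  {ae mu, forall x, P x} -> {ae mu, forall x, Q x} -> {ae mu, forall x, S x}.
Proof. exact: filterS2. Qed.

End AlmostEverywhere.

Section PosteriorDensity.
Context (R : realType) (X Y : normedModType R) (B : inverse_problem X Y).
Implicit Types (y : Y) (t : X).

(** The density of the posterior with respect to the prior. The likelihood is
    truncated at 0, which changes it on a set of prior measure 0 only, to make
    the density nonnegative everywhere. *)
Definition posterior_density (y : Y) (t : X) : R :=
  Num.max 0 (likelihood B y t) / fine (evidence B y).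

Lemma measurable_posterior_density y :
  measurable_fun setT (posterior_density y : borel X -> R).
Proof.
apply: measurable_funM => //; apply: measurable_maxr => //.
exact: measurable_likelihood.
Qed.

Lemma evidence_ge0 y : (0 <= evidence B y)%E.
Proof.
rewrite /evidence (ae_eq_integral
  (fun t : borel X => (Num.max 0 (likelihood B y t))%:E))//.
- by apply: integral_ge0 => t _; rewrite lee_fin le_max lexx.
- by apply/measurable_EFinP; exact: measurable_likelihood.
- apply/measurable_EFinP; apply: measurable_maxr => //.
  exact: measurable_likelihood.
- by apply: ae_imply (likelihood_ge0 B) => t Lt _; rewrite max_r.
Qed.

Lemma posterior_density_ge0 y t : 0 <= posterior_density y t.
Proof. by rewrite divr_ge0 ?le_max ?lexx// fine_ge0// evidence_ge0. Qed.

(** The likelihood may be negative on a set that is null for the prior but not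
    for [nuX]; the prior density vanishes there. *)
Lemma ae_nuX_posterior_density y : {ae nuX B, forall t,
  likelihood B y t * prior_density B t / fine (evidence B y) =
  posterior_density y t * prior_density B t}.
Proof.
have := density_ae (prior_densityP B) (likelihood_ge0 B).
apply: ae_imply => t; rewrite /posterior_density mulrAC.
have [->|_ /(_ isT)/(_ y) Lt] := eqVneq (prior_density B t) 0.
  by rewrite !mulr0.
by rewrite max_r.
Qed.

Lemma integral_posterior_density y (A : set (borel X)) : measurable A ->
  (\int[nuX B]_(t in A)
    (likelihood B y t * prior_density B t / fine (evidence B y))%:E =
   \int[prior B]_(t in A) (posterior_density y t)%:E)%E.
Proof.
move=> mA; have mpd := measurable_posterior_density y.
have [mpi _ _] := prior_densityP B.
rewrite (ge0_integral_density (prior_densityP B))//; last 2 first.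
- exact/measurable_EFinP.
- by move=> t; rewrite lee_fin posterior_density_ge0.
apply: ae_eq_integral => //.
- apply/measurable_funTS/measurable_EFinP; apply: measurable_funM => //.
  by apply: measurable_funM => //; exact: measurable_likelihood.
- by apply/measurable_funTS/emeasurable_funM; exact/measurable_EFinP.
- by apply: ae_imply (ae_nuX_posterior_density y) => t -> _; rewrite EFinM.
Qed.

Lemma is_posterior_density y (mu : probability (borel X) R) :
  is_posterior B y mu -> is_density (prior B) mu (posterior_density y).
Proof.
move=> [_ _ [_ _ muE]]; split; first exact: measurable_posterior_density.
  by apply: aeW => t; exact: posterior_density_ge0.
by move=> A mA; rewrite muE// integral_posterior_density.
Qed.

Lemma density_is_posterior y (mu : probability (borel X) R) :
  (0 < evidence B y < +oo)%E ->
  is_density (prior B) mu (posterior_density y) -> is_posterior B y mu.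
Proof.
move=> Zy muP; split => //; first exact: density_dominated muP.
have [_ _ muE] := muP; have [mpi pi0 _] := prior_densityP B.
split.
- apply: measurable_funM => //; apply: measurable_funM => //.
  exact: measurable_likelihood.
- apply: ae_imply2 pi0 (ae_nuX_posterior_density y) => t pit ->.
  by rewrite mulr_ge0// posterior_density_ge0.
- by move=> A mA; rewrite muE// integral_posterior_density.
Qed.

Lemma posterior_unique y (mu mu' : probability (borel X) R) :
  is_posterior B y mu -> is_posterior B y mu' ->
  forall A, measurable A -> mu A = mu' A.
Proof. by move=> [_ _ [_ _ muE]] [_ _ [_ _ mu'E]] A mA; rewrite muE// mu'E. Qed.

Lemma evidence_gt0 y :
  {ae prior B, forall t, 0 < likelihood B y t} -> (0 < evidence B y)%E.
Proof.
(* If the evidence were 0, the positive function L(y|.) would vanish almost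
   everywhere, and the prior would be the zero measure. *)
move=> L0; rewrite lt0e evidence_ge0 andbT; apply/eqP => Z0.
have mL : measurable_fun setT (EFin \o (likelihood B y : borel X -> R)).
  by apply/measurable_EFinP; exact: measurable_likelihood.
have : (\int[prior B]_t `|(likelihood B y t)%:E| = 0)%E.
  rewrite -Z0; apply: ae_eq_integral => //; first exact: measurableT_comp.
  by apply: ae_imply L0 => t Lt _; rewrite /= gtr0_norm.
move/(ae_eq_integral_abs _ measurableT mL) => L_0.
have : {ae prior B, forall t : borel X, False}.
  apply: ae_imply2 L0 L_0 => t Lt /(_ I) /= [Lt0].
  by move: Lt; rewrite Lt0 ltxx.
move=> [N [mN N0 subN]].
have NT : N = setT by apply/seteqP; split => t // _; exact: (subN t).
have := probability_setT (prior B); rewrite -NT N0 => /eqP.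
by rewrite eqe eq_sym oner_eq0.
Qed.

End PosteriorDensity.

(** * Existence, moments and evidence *)

Section WellPosed.
Context (R : realType) (X Y : normedModType R) (B : inverse_problem X Y).
Implicit Types (y : Y) (t : X).

Lemma exists_posterior y : (0 < evidence B y)%E ->
  (prior B).-integrable setT (EFin \o likelihood B y) ->
  exists mu : probability (borel X) R, is_posterior B y mu.
Proof.
move=> Z0 iL.
have Zfin : evidence B y \is a fin_num by exact: integrable_fin_num.
have fZ0 : 0 < fine (evidence B y).
  by rewrite fine_gt0// Z0 ltey_eq Zfin.
have mpd := measurable_posterior_density B y.
have pd1 : (\int[prior B]_t (posterior_density B y t)%:E = 1)%E.
  transitivity (\int[prior B]_t
      ((fine (evidence B y))^-1%:E * (likelihood B y t)%:E))%E.
    apply: ae_eq_integral => //.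
    - exact/measurable_EFinP.
    - apply: emeasurable_funM => //; apply/measurable_EFinP.
      exact: measurable_likelihood.
    - apply: ae_imply (likelihood_ge0 B) => t Lt _.
      by rewrite /posterior_density max_r// mulrC EFinM.
  rewrite integralZl//= -/(evidence B y) -[X in (_ * X)%E]fineK//.
  by rewrite -EFinM mulVf// gt_eqF.
have [M ME] : exists M : {finite_measure set (borel X) -> \bar R},
    forall A, M A = (\int[prior B]_(t in A) (posterior_density B y t)%:E)%E.
  apply: exists_density_measure => //; last by rewrite pd1 ltry.
  by move=> t; exact: posterior_density_ge0.
have MT : M setT = 1%E by rewrite ME.
have [mu muE] := probability_of_measure MT.
exists mu; apply: density_is_posterior; first by rewrite Z0 ltey_eq Zfin.
split => //; first by apply: aeW => t; exact: posterior_density_ge0.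
by move=> A _; exact: etrans (muE A) (ME A).
Qed.

Lemma posterior_moment_lty (p : R) y (g' : X -> R)
    (mu : probability (borel X) R) :
  is_posterior B y mu -> (prior B).-integrable setT (EFin \o g') ->
  {ae prior B, forall t, `|t| `^ p * likelihood B y t <= g' t} ->
  Prob p mu.
Proof.
move=> muP ig' Lg'; have dens := is_posterior_density muP.
have [/andP[Z0 Zoo] _ _] := muP.
have fZ0 : 0 < fine (evidence B y) by rewrite fine_gt0// Z0.
have mn := @measurable_powR_norm R X p.
have mpd := measurable_posterior_density B y.
rewrite /Prob/= (ge0_integral_density dens)//; last exact/measurable_EFinP.
have mg' := measurable_int _ ig'.
apply: (@le_lt_trans _ _ (\int[prior B]_t
    ((fine (evidence B y))^-1%:E * `|(g' t)%:E|))%E).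
  apply: ae_ge0_le_integral => //.
  - by move=> t _; rewrite mule_ge0// lee_fin ?powR_ge0// posterior_density_ge0.
  - by apply: emeasurable_funM; exact/measurable_EFinP.
  - by move=> t _; rewrite mule_ge0// lee_fin invr_ge0 ltW.
  - by apply: emeasurable_funM => //; exact: measurableT_comp.
  - apply: ae_imply2 (likelihood_ge0 B) Lg' => t Lt Lg' _.
    rewrite -EFinM lee_fin /posterior_density max_r// mulrA mulrC ler_pM2l ?invr_gt0//.
    by rewrite (le_trans Lg')// ler_norm.
rewrite ge0_integralZl//; last 2 first.
- exact: measurableT_comp.
- by rewrite lee_fin invr_ge0 ltW.
by rewrite lte_mul_pinfty// ?lee_fin ?invr_ge0 1?ltW//; case/integrableP: ig'.
Qed.

(** Sequential continuity of the evidence, by dominated convergence. *)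
Lemma cvg_evidence (g : X -> R) y0 (u : nat -> Y) :
  (prior B).-integrable setT (EFin \o g) ->
  {ae prior B, forall t, forall y, likelihood B y t <= g t} ->
  {ae prior B, forall t, continuous (likelihood B ^~ t)} ->
  u n @[n --> \oo] --> y0 ->
  evidence B (u n) @[n --> \oo] --> evidence B y0.
Proof.
move=> ig Lg Lc uy0.
have mL y : measurable_fun setT (EFin \o (likelihood B y : borel X -> R)).
  by apply/measurable_EFinP; exact: measurable_likelihood.
have cL : {ae prior B, forall t : borel X, setT t ->
    (likelihood B (u n) t)%:E @[n --> \oo] --> (likelihood B y0 t)%:E}.
  apply: ae_imply Lc => t Lc _; apply: cvg_EFin; first exact: nearW.
  exact: (cvg_comp _ _ uy0 (Lc y0)).
have bL : {ae prior B, forall (t : borel X) n, setT t ->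
    (`|(likelihood B (u n) t)%:E| <= (g t)%:E)%E}.
  apply: ae_imply2 (likelihood_ge0 B) Lg => t Lt Lg n _.
  by rewrite /= ger0_norm// lee_fin.
by have [_ _] := dominated_convergence measurableT
  (fun n => mL (u n)) (mL y0) cL ig bL.
Qed.

End WellPosed.

(** * Continuity of the posterior *)

Section Continuity.
Context (R : realType) (X Y : normedModType R) (B : inverse_problem X Y).

Lemma cvg_weighted_L1_posterior_density (p : R) (g' : X -> R) y0
    (u : nat -> Y) :
  (prior B).-integrable setT (EFin \o g') ->
  {ae prior B, forall t, forall y, `|t : X| `^ p * likelihood B y t <= g' t} ->
  {ae prior B, forall t, continuous (likelihood B ^~ t)} ->
  (forall y, 0 < fine (evidence B y)) ->
  fine (evidence B (u n)) @[n --> \oo] --> fine (evidence B y0) ->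
  u n @[n --> \oo] --> y0 ->
  (\int[prior B]_t (2 `^ p * `|t : X| `^ p *
     `|posterior_density B (u n) t - posterior_density B y0 t|)%:E)%E
    @[n --> \oo] --> 0%E.
Proof.
move=> ig' Lg' Lc Z0 cZ uy0.
pose Z y := fine (evidence B y).
have cV : (Z (u n))^-1 @[n --> \oo] --> (Z y0)^-1.
  by apply: cvgV => //; rewrite gt_eqF// Z0.
have [M M0 ZM] : exists2 M : R, 0 < M & forall n, (Z (u n))^-1 <= M.
  have /cvg_seq_bounded/pinfty_ex_gt0[M M0 ZM] :
    cvg ((fun n => (Z (u n))^-1) @ \oo) by apply/cvg_ex; eexists; exact: cV.
  exists M => // n; apply: le_trans (ZM n I); exact: ler_norm.
(* C * |g'| dominates: |t|^p (f_y + f_y0) <= (1 / Z y + 1 / Z y0) * g' t, with M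
   bounding the convergent sequence of the 1 / Z (u n). *)
pose w (t : X) : R := 2 `^ p * `|t| `^ p.
pose C := 2 `^ p * (M + (Z y0)^-1).
have C0 : 0 <= C by rewrite mulr_ge0 ?powR_ge0// addr_ge0 ?invr_ge0// ltW ?Z0.
pose F n (t : borel X) : \bar R :=
  (w t * `|posterior_density B (u n) t - posterior_density B y0 t|)%:E.
have mF n : measurable_fun setT (F n).
  apply/measurable_EFinP; apply: measurable_funM.
    by apply: measurable_funM => //; exact: measurable_powR_norm.
  apply: measurableT_comp => //.
  by apply: measurable_funB; exact: measurable_posterior_density.
have mg' := measurable_int _ ig'.
have iG : (prior B).-integrable setT (fun t => C%:E * `|(g' t)%:E|)%E.
  by apply: integrableZl => //; exact: integrable_abse.
have cF : {ae prior B, forall t : borel X, setT t -> F ^~ t @ \oo --> 0%E}.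
  apply: ae_imply2 (likelihood_ge0 B) Lc => t Lt Lc _.
  apply: cvg_EFin; first exact: nearW.
  rewrite -[X in _ --> X](mulr0 (w t)).
  apply: cvgMr.
  rewrite -[X in _ --> X](@normr0 R R); apply: cvg_norm.
  rewrite -[X in _ --> X](subrr (posterior_density B y0 t)).
  apply: cvgB; last exact: cvg_cst.
  rewrite /posterior_density.
  under eq_fun do rewrite max_r//.
  rewrite max_r//; apply: cvgM => //.
  exact: (cvg_comp _ _ uy0 (Lc y0)).
have bF : {ae prior B, forall (t : borel X) n, setT t ->
    (`|F n t| <= C%:E * `|(g' t)%:E|)%E}.
  apply: ae_imply2 (likelihood_ge0 B) Lg' => t Lt Lg n _.
  rewrite /F -EFinM lee_fin ger0_norm ?mulr_ge0 ?powR_ge0//.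
  rewrite /w /C -!mulrA ler_wpM2l ?powR_ge0//.
  apply: (@le_trans _ _ (`|t : X| `^ p *
      (posterior_density B (u n) t + posterior_density B y0 t))).
    rewrite ler_wpM2l ?powR_ge0// (le_trans (ler_normB _ _))//.
    by rewrite !ger0_norm ?posterior_density_ge0.
  have bound y K : (Z y)^-1 <= K ->
      `|t : X| `^ p * posterior_density B y t <= K * `|g' t|.
    move=> ZK; rewrite /posterior_density max_r// mulrA mulrC.
    apply: ler_pM => //; first by rewrite invr_ge0 ltW// Z0.
      by rewrite mulr_ge0// powR_ge0.
    by rewrite (le_trans (Lg y))// ler_norm.
  by rewrite mulrDr mulrDl lerD// bound.
have [_ _] := dominated_convergence measurableT mF (measurable_cst 0%E) cF iG bF.
by rewrite integral0.
Qed.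

Lemma cvg_wasserstein_posterior (p : R) (g g' : X -> R)
    (post : Y -> probability (borel X) R) (y0 : Y) :
  @second_countable X -> 0 < p ->
  (prior B).-integrable setT (EFin \o g) ->
  {ae prior B, forall t, forall y, likelihood B y t <= g t} ->
  (prior B).-integrable setT (EFin \o g') ->
  {ae prior B, forall t, forall y, `|t : X| `^ p * likelihood B y t <= g' t} ->
  {ae prior B, forall t, continuous (likelihood B ^~ t)} ->
  (forall y, is_posterior B y (post y)) ->
  wasserstein p (post y) (post y0) @[y --> y0] --> 0%E.
Proof.
move=> scX p0 ig Lg ig' Lg' Lc postP.
have Zfin y : evidence B y \is a fin_num.
  by have [/andP[Z0 Zoo] _ _] := postP y; rewrite ge0_fin_numE// ltW.
have fZ0 y : 0 < fine (evidence B y).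
  by have [/andP[Z0 Zoo] _ _] := postP y; rewrite fine_gt0// Z0.
apply: cvg_seqP => u uy0.
have cZ : fine (evidence B (u n)) @[n --> \oo] --> fine (evidence B y0).
  apply: fine_cvg; rewrite fineK//; exact: cvg_evidence ig Lg Lc uy0.
pose F n := (\int[prior B]_t (2 `^ p * `|t : X| `^ p *
  `|posterior_density B (u n) t - posterior_density B y0 t|)%:E)%E.
have F_0 : F n @[n --> \oo] --> 0%E.
  exact: cvg_weighted_L1_posterior_density ig' Lg' Lc fZ0 cZ uy0.
have F0 n : (0 <= F n)%E.
  by apply: integral_ge0 => t _; rewrite lee_fin !mulr_ge0// powR_ge0.
apply/ge0_cvge0P => [n|e e0]; first exact: poweR_ge0.
(* Eventually F n < (e / 2)^p, whose 1/p-th power e / 2 is less than e. *)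
have e20 : 0 < e / 2 by rewrite divr_gt0.
move/(ge0_cvge0P F0)/(_ ((e / 2) `^ p) (powR_gt0 _ e20)) : F_0.
apply: filterS => n Fe.
apply: (@le_lt_trans _ _ (F n `^ p^-1)%E).
  apply: wasserstein_le => //.
  - exact: is_posterior_density.
  - exact: is_posterior_density.
  - by move=> t; exact: posterior_density_ge0.
  - by move=> t; exact: posterior_density_ge0.
apply: (@le_lt_trans _ _ (((e / 2) `^ p)%:E `^ p^-1)%E).
  apply: gt0_ler_poweR => //; last exact: ltW.
  - by rewrite invr_ge0 ltW.
  - by rewrite in_itv/= leey F0.
  - by rewrite in_itv/= leey lee_fin powR_ge0.
rewrite poweR_EFin -powRrM divff ?gt_eqF// powRr1 ?ltW// lte_fin.
by rewrite ltr_pdivrMr// ltr_pMr// ltr1n.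
Qed.

End Continuity.

Theorem theorem3p12 (R : realType) (X' : topologicalLmodType R)
    (X : normedModType R) (emb : X -> X') (Y : completeNormedModType R)
    (p : R) (B : inverse_problem X Y)
    (X_param : parameter_space emb)
    (Y_sep : separable Y)
    (p_ge1 : 1 <= p)
    (A1 : {ae prior B, forall t, is_positive_pdf (nuY B) (likelihood B ^~ t)})
    (A2 : forall y, (prior B).-integrable setT (EFin \o likelihood B y))
    (A3 : exists2 g : X -> R, (prior B).-integrable setT (EFin \o g) &
      {ae prior B, forall t, forall y, likelihood B y t <= g t})
    (A4 : {ae prior B, forall t, continuous (likelihood B ^~ t)})
    (A5 : exists2 g' : X -> R, (prior B).-integrable setT (EFin \o g') &
      {ae prior B, forall t, forall y,
        `|t : X| `^ p * likelihood B y t <= g' t}) :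
  wasserstein_well_posed p B.
Proof.
have p0 : 0 < p by exact: lt_le_trans p_ge1.
have [g ig Lg] := A3; have [g' ig' Lg'] := A5.
split=> [y|y mu mu' _ muP _ mu'P|post postP y0].
- have [|mu muP] := @exists_posterior _ _ _ B y _ (A2 y).
    by apply: evidence_gt0; apply: ae_imply A1 => t [_ + _]; exact.
  exists mu => //; apply: (posterior_moment_lty muP ig').
  by apply: ae_imply Lg' => t; exact.
- exact: posterior_unique muP mu'P.
- apply: (@cvg_wasserstein_posterior _ _ _ B p g g' post y0) => //.
    exact: parameter_space_second_countable X_param.
  by move=> y; have [] := postP y.
Qed.
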